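(* Let $(X,\omega)$ be a connected compact complex manifold of complex dimension $n$ endowed with a smooth Hermitian metric $\omega$. Let $\sigma$ be any nowhere vanishing smooth probability distribution on $X$. For each $k\in\mathbb N$, $k\ge1$, let $E_k\subset X$ be any finite set, with cardinalities satisfying $\#E_k\simeq k^n$ (that is, $A^{-1}k^n\le\#E_k\le A k^n$ for some constant $A\ge1$ independent of $k$), and let $\mu_k=\frac{1}{\#E_k}\sum_{x\in E_k}\delta_x$. Then there is a constant $c>0$, independent of $k$, such that $$W(\mu_k,\sigma)\ge \frac{c}{\sqrt k}$$ for all $k$, where $W$ is the Kantorovich-Wasserstein distance.
   Context: For probability measures $\mu,\nu$ on $X$, the Kantorovich-Wasserstein distance is $W(\mu,\nu)=\inf_\rho\iint_{X\times X}d(x,y)\,d\rho(x,y)$, where $d$ is the distance associated with the metric $\omega$ and the infimum is over all probability measures $\rho$ on $X\times X$ with marginals $\mu$ and $\nu$. A nowhere vanishing smooth probability distribution is a probability measure given by a smooth, everywhere strictly positive density with respect to the Riemannian volume. *)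

(* Defs.v *)
(* MathComp-Analysis, over an arbitrary [R : realType]. *)
From HB Require Import structures.
From mathcomp Require Import all_boot all_order all_algebra.
From mathcomp Require Import finmap.
From mathcomp Require Import all_classical all_reals all_analysis.
From mathcomp Require Import complex.

Set Implicit Arguments.
Unset Strict Implicit.
Unset Printing Implicit Defensive.

Import Order.TTheory GRing.Theory Num.Theory numFieldNormedType.Exports.

Local Open Scope classical_set_scope.
Local Open Scope ring_scope.
Local Open Scope sesquilinear_scope.

(* A separate name for [R[i]], so that the normed-module structures that the
   library declares on abstract number fields are found on it. *)
Definition C (R : realType) : numClosedFieldType := R[i].

(* C^n as R^(2n): the first n coordinates are the real parts. *)
Definition toC (R : realType) (n : nat) (v : 'rV[R]_(n + n)) : 'rV[C R]_n :=
  \row_j (Complex (v 0 (lshift n j)) (v 0 (rshift n j)) : C R).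

Definition toR (R : realType) (n : nat) (z : 'rV[C R]_n) : 'rV[R]_(n + n) :=
  row_mx (\row_j complex.Re (z 0 j)) (\row_j complex.Im (z 0 j)).

(* C^k and C^oo real functions on an open subset U of R^m. *)
Fixpoint Ck_on (R : realType) (m k : nat) (U : set 'rV[R]_m)
    (f : 'rV[R]_m -> R) : Prop :=
  (forall v, U v -> {for v, continuous f}) /\
  match k with
  | 0 => True
  | k'.+1 => forall w : 'rV[R]_m,
      (forall v, U v -> derivable f v w) /\ Ck_on k' U (fun v => 'D_w f v)
  end.

Definition smooth_on (R : realType) (m : nat) (U : set 'rV[R]_m)
    (f : 'rV[R]_m -> R) : Prop :=
  forall k, Ck_on k U f.

(* A chart is a homeomorphism from the open set [cdom] onto an open subset of
   C^n; [coord] and [icoord] are total functions whose values outside [cdom],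
   respectively outside the image of [cdom], are irrelevant. *)
Record chart (R : realType) (n : nat) (X : ptopologicalType) := Chart {
  cdom : set X;
  coord : X -> 'rV[C R]_n;
  icoord : 'rV[C R]_n -> X;
  cdom_open : open cdom;
  image_open : open (coord @` cdom);
  coord_continuous : forall x, cdom x -> {for x, continuous coord};
  icoord_continuous :
    forall z, (coord @` cdom) z -> {for z, continuous icoord};
  coordK : forall x, cdom x -> icoord (coord x) = x }.

(* [differentiable] is taken over the field of complex numbers here, so that the
   transition maps are holomorphic. *)
Record complexManifold (R : realType) (n : nat) (X : ptopologicalType) :=
  ComplexManifold {
  aindex : Type;
  atlas : aindex -> chart R n X;
  atlas_cover : forall x, exists a, cdom (atlas a) x;
  atlas_holomorphic : forall a b x, cdom (atlas a) x -> cdom (atlas b) x ->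
    differentiable (coord (atlas b) \o icoord (atlas a)) (coord (atlas a) x) }.

Section Charts.
Variables (R : realType) (n : nat) (X : ptopologicalType).
Variable M : complexManifold R n X.

Definition adom (a : aindex M) : set X := cdom (atlas a).

Definition rcoord (a : aindex M) (x : X) : 'rV[R]_(n + n) :=
  toR (coord (atlas a) x).

Definition ricoord (a : aindex M) (v : 'rV[R]_(n + n)) : X :=
  icoord (atlas a) (toC v).

Definition rcodom (a : aindex M) : set 'rV[R]_(n + n) := rcoord a @` adom a.

Definition chart_at (x : X) : aindex M := projT1 (cid (atlas_cover M x)).

Definition smooth (f : X -> R) : Prop :=
  forall a, smooth_on (rcodom a) (f \o ricoord a).

(* Differential at x of the change of coordinates from chart a to chart b. *)
Definition dtransition (a b : aindex M) (x : X) (u : 'rV[C R]_n) : 'rV[C R]_n :=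
  'd (coord (atlas b) \o icoord (atlas a)) (coord (atlas a) x) u.

End Charts.

(* The sesquilinear form of matrix H, conjugate-linear in the second argument. *)
Definition hform (R : realType) (n : nat) (H : 'M[C R]_n) (u w : 'rV[C R]_n) :
    C R :=
  (u *m H *m w ^t*) 0 0.

(* A smooth Hermitian metric, given by its matrix in every chart of the atlas;
   [0 < z] in [C R] means that z is real and positive. *)
Record hermitianMetric (R : realType) (n : nat) (X : ptopologicalType)
    (M : complexManifold R n X) := HermitianMetric {
  hmx : aindex M -> X -> 'M[C R]_n;
  hmx_hermitian : forall a x, adom a x -> hmx a x \is hermsymmx;
  hmx_posdef : forall a x, adom a x ->
    forall u : 'rV[C R]_n, u != 0 -> 0 < hform (hmx a x) u u;
  hmx_smooth : forall a i j,
    smooth_on (rcodom a) (fun v => complex.Re (hmx a (ricoord a v) i j)) /\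
    smooth_on (rcodom a) (fun v => complex.Im (hmx a (ricoord a v) i j));
  hmx_compat : forall a b x, adom a x -> adom b x ->
    forall u w : 'rV[C R]_n,
    hform (hmx a x) u w =
    hform (hmx b x) (dtransition a b x u) (dtransition a b x w) }.

(* Integral over R^m of a nonnegative Borel function with respect to the
   m-dimensional Lebesgue measure, as an iterated integral (Tonelli). *)
Fixpoint lebesgue_integral_rV (R : realType) (m : nat) :
    ('rV[R]_m -> \bar R) -> \bar R :=
  match m with
  | 0 => fun f => f 0
  | p.+1 => fun f => (\int[@lebesgue_measure R]_x
      lebesgue_integral_rV (fun v : 'rV[R]_p => f (row_mx (x%:M : 'M[R]_1) v)))%E
  end.

Notation borel X := (g_sigma_algebraType (@open X)).

Section HermitianManifold.
Variables (R : realType) (n : nat) (X : ptopologicalType).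
Variables (M : complexManifold R n X) (h : hermitianMetric M).

(* The underlying Riemannian metric, the real part of the Hermitian one, in the
   real coordinates of the chart a. *)
Definition riemannian (a : aindex M) (x : X) (v w : 'rV[R]_(n + n)) : R :=
  complex.Re (hform (hmx h a x) (toC v) (toC w)).

Definition gram (a : aindex M) (x : X) : 'M[R]_(n + n) :=
  \matrix_(i, j) riemannian a x (delta_mx 0 i) (delta_mx 0 j).

Definition C1_curve (g : R -> X) : Prop :=
  continuous g /\
  forall (a : aindex M) (t : R), adom a (g t) ->
    (\forall s \near t, derivable (rcoord a \o g) s 1) /\
    {for t, continuous (derive1 (rcoord a \o g))}.

(* By [hmx_compat], any chart at [g t] gives the same value. *)
Definition speed (g : R -> X) (t : R) : R :=
  let a := chart_at M (g t) in
  let v := derive1 (rcoord a \o g) t in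
  Num.sqrt (riemannian a (g t) v v).

Definition curve_length (g : R -> X) : \bar R :=
  (\int[@lebesgue_measure R]_(t in `[0%R, 1%R]) (speed g t)%:E)%E.

(* Only the restriction of g to [0, 1] matters, and a C^1 curve on [0, 1] always
   extends to R.  Piecewise C^1 curves give the same infimum, since a corner can
   be passed at zero speed. *)
Definition hdist (x y : X) : \bar R :=
  ereal_inf [set curve_length g | g in
    [set g : R -> X | [/\ C1_curve g, g 0 = x & g 1 = y]]].

Definition riemannian_volume (vol : {measure set (borel X) -> \bar R}) : Prop :=
  forall (a : aindex M) (A : set (borel X)), measurable A -> A `<=` adom a ->
    vol A = lebesgue_integral_rV (fun v : 'rV[R]_(n + n) =>
      (\1_(rcoord a @` A) v * Num.sqrt (\det (gram a (ricoord a v))))%:E).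

(* The measure vol is unique: X is covered by countably many charts when it is
   compact. *)
Definition nowhere_vanishing_smooth (sigma : probability (borel X) R) : Prop :=
  exists (vol : {measure set (borel X) -> \bar R}) (f : X -> R),
    [/\ riemannian_volume vol, smooth M f, forall x, 0 < f x &
        forall A : set (borel X), measurable A ->
          sigma A = (\int[vol]_(x in A) (f x)%:E)%E].

End HermitianManifold.

Section Wasserstein.
Variables (R : realType) (X : ptopologicalType).

Definition coupling (mu nu : probability (borel X) R)
    (rho : probability (borel X * borel X)%type R) : Prop :=
  forall A : set (borel X), measurable A ->
    rho (A `*` setT) = mu A /\ rho (setT `*` A) = nu A.

Definition wasserstein (d : X -> X -> \bar R) (mu nu : probability (borel X) R) :
    \bar R :=
  ereal_inf [set (\int[rho]_p d p.1 p.2)%E | rho in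
    [set rho : probability (borel X * borel X)%type R | coupling mu nu rho]].

Definition empirical_measure (E : {fset X}) (mu : probability (borel X) R) :
    Prop :=
  forall A : set (borel X), measurable A ->
    mu A = ((#|` E|%:R^-1)%:E * \sum_(x <- E) dirac (x : borel X) A)%E.

End Wasserstein.

(* Main.v *)
Require Import Defs.
From HB Require Import structures.
From mathcomp Require Import all_boot all_order all_algebra.
From mathcomp Require Import finmap.
From mathcomp Require Import all_classical all_reals all_analysis.
From mathcomp Require Import complex ring lra.

Set Implicit Arguments.
Unset Strict Implicit.
Unset Printing Implicit Defensive.

Import Order.TTheory GRing.Theory Num.Theory numFieldNormedType.Exports.

Local Open Scope classical_set_scope.
Local Open Scope ring_scope.
Local Open Scope sesquilinear_scope.

(* Over a coupling of mu_k and sigma, mass can only leave the r-neighbourhood of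
   E_k at cost at least r.  That neighbourhood is a union of #E_k balls of
   sigma-mass O(r^(2n)) each, so for r = const / sqrt k its mass is at most 1/2
   and at least half of the mass has to be moved by at least r.

   Both estimates on balls are made with coordinate balls, uniformly in the
   centre by compactness.  A curve leaving the coordinate ball of radius r has
   length at least const * r, since the Hermitian metric dominates a multiple of
   the coordinate norm near each point; that the curve cannot leave the chart
   without crossing the coordinate sphere is where Hausdorffness enters.

   Neither the distance nor the integrands of the iterated Lebesgue integral are
   known to be measurable.  This is harmless: the integral of a nonnegative
   function is the supremum of the integrals of the simple functions below it,
   hence monotone for all functions. *)

(** * The sup norm of matrices *)

Lemma normr_mx_entry (K : numDomainType) m n (x : 'M[K]_(m, n)) i j :
  `|x i j| <= `|x|.
Proof.
rewrite [leRHS]/Num.Def.normr /= mx_normE -[leLHS]nngE num_le.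
exact: (le_bigmax _ _ (i, j)).
Qed.

Lemma normr_mx_le (K : numDomainType) m n (x : 'M[K]_(m, n)) e :
  0 <= e -> (forall i j, `|x i j| <= e) -> `|x| <= e.
Proof.
move=> /nonnegP[{}e] xe; rewrite [leLHS]/Num.Def.normr /= mx_normE num_le.
by apply/bigmax_leP; split=> [|[i j] _] //=; rewrite -num_le /=.
Qed.

Lemma normr_mx_lt (K : numDomainType) m n (x : 'M[K]_(m, n)) e :
  0 < e -> (forall i j, `|x i j| < e) -> `|x| < e.
Proof.
move=> /[dup] /ltW/nonnegP[{}e] e_gt0 xe.
rewrite [ltLHS]/Num.Def.normr /= mx_normE num_lt.
apply/bigmax_ltP; rewrite -num_lt /=; split=> // -[i j] _ /=.
by rewrite -num_lt /=.
Qed.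

(** * Passing between real and complex coordinates *)

Section RealComplexCoordinates.
Variable R : realType.
Local Notation "x %:C" := (@real_complex R x : C R) : ring_scope.

(** Turns epsilon arguments over [C R] into real ones. *)
Lemma posC_real (e : C R) : 0 < e -> exists2 r : R, 0 < r & e = r%:C.
Proof. by case: e => a b; rewrite ltcE /= => /andP[/eqP -> ?]; exists a. Qed.

Lemma normC_le (z : C R) : `|z| <= (`|complex.Re z| + `|complex.Im z|)%:C.
Proof.
rewrite [leLHS]normc_def lecR -[leRHS]ger0_norm ?addr_ge0 //.
rewrite -[leRHS]sqrtr_sqr.
rewrite ler_wsqrtr // sqrrD !real_normK ?num_real // -addrA lerD2l.
by rewrite lerDr mulrn_wge0 // mulr_ge0.
Qed.

Lemma ler_normC_Re (z : C R) : `|complex.Re z|%:C <= `|z|.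
Proof. exact: normc_ge_Re. Qed.

Lemma ler_normC_Im (z : C R) : `|complex.Im z|%:C <= `|z|.
Proof.
rewrite [leRHS]normc_def lecR -sqrtr_sqr.
by rewrite ler_wsqrtr // lerDr sqr_ge0.
Qed.

Variable n : nat.
Implicit Types (u v : 'rV[R]_(n + n)) (z w : 'rV[C R]_n).

Lemma toCK : cancel (@toC R n) (@toR R n).
Proof.
move=> v; apply/rowP => i; rewrite mxE.
by case: splitP => j ij; rewrite !mxE /=; congr (v 0 _); apply/val_inj.
Qed.

Lemma toRK : cancel (@toR R n) (@toC R n).
Proof.
move=> z; apply/rowP => i; rewrite !mxE /=.
rewrite (unsplitK (inl i)) (unsplitK (inr i)) !mxE.
by case: (z 0 i).
Qed.

Lemma toCD u v : toC (u + v) = toC u + toC v.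
Proof. by apply/rowP => i; rewrite !mxE. Qed.

Lemma toCN v : toC (- v) = - toC v.
Proof. by apply/rowP => i; rewrite !mxE. Qed.

Lemma toCB u v : toC (u - v) = toC u - toC v.
Proof. by rewrite toCD toCN. Qed.

Lemma toCZ (a : R) v : toC (a *: v) = a%:C *: toC v.
Proof.
apply/rowP => i; rewrite !mxE /=.
by apply/eqP; rewrite eq_complex /= !mul0r subr0 addr0 !eqxx.
Qed.

Lemma toC0 : toC (0 : 'rV[R]_(n + n)) = 0.
Proof. by apply/rowP => i; rewrite !mxE. Qed.

Lemma toRB z w : toR (z - w) = toR z - toR w.
Proof. by rewrite -{1}(toRK z) -{1}(toRK w) -toCB toCK. Qed.

(** Both sides are sup norms, over moduli of complex entries and over real entries; the factor 2
    comes from bounding a modulus by the sum of the absolute real and imaginary parts. *)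
Lemma norm_toC v : `|toC v| <= (2 * `|v|)%:C.
Proof.
apply: normr_mx_le; first by rewrite ler0c mulr_ge0.
move=> i j; rewrite mxE; apply: le_trans (normC_le _) _.
by rewrite lecR mulr_natl mulr2n lerD // normr_mx_entry.
Qed.

Lemma norm_toR z : `|toR z|%:C <= `|z|.
Proof.
have [r r0 er] : exists2 r : R, 0 <= r & `|z| = r%:C.
  have [-> |z0] := eqVneq z 0; first by exists 0; rewrite ?normr0.
  have [|r r0 ->] := @posC_real `|z|; first by rewrite normr_gt0.
  by exists r => //; exact: ltW.
rewrite er lecR; apply: normr_mx_le => // i j; rewrite -lecR -er ord1 mxE.
case: splitP => k _; rewrite mxE; apply: le_trans (normr_mx_entry z 0 k).
  exact: ler_normC_Re.
exact: ler_normC_Im.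
Qed.

Lemma toC_continuous : continuous (@toC R n).
Proof.
move=> v; apply/(@cvgrPdist_lt _ _ _ (nbhs v)) => _ /posC_real[r r0 ->].
near=> u; rewrite -toCB; apply: le_lt_trans (norm_toC _) _.
rewrite ltcR mulrC -ltr_pdivlMr //.
near: u; apply: filterS (@nbhsx_ballx _ _ v (r / 2) _) => [u|].
  by rewrite -ball_normE.
by rewrite divr_gt0.
Unshelve. all: by end_near. Qed.

Lemma toR_continuous : continuous (@toR R n).
Proof.
move=> z; apply/(@cvgrPdist_lt _ _ _ (nbhs z)) => r r0.
near=> w; rewrite -ltcR -toRB; apply: le_lt_trans (norm_toR _) _.
near: w; apply: filterS (@nbhsx_ballx _ _ z r%:C _) => [w|].
  by rewrite -ball_normE.
by rewrite ltcR.
Unshelve. all: by end_near. Qed.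

End RealComplexCoordinates.

(** * Integrals of nonnegative functions not known to be measurable *)

Section LowerIntegral.
Local Open Scope ereal_scope.

Lemma ge0_le_integral_nonmeasurable d (T : measurableType d) (R : realType)
    (mu : {measure set T -> \bar R}) (D1 D2 : set T) (f g : T -> \bar R) :
  D1 `<=` D2 -> (forall x, 0 <= f x) -> (forall x, 0 <= g x) ->
  (forall x, D1 x -> f x <= g x) ->
  \int[mu]_(x in D1) f x <= \int[mu]_(x in D2) g x.
Proof.
move=> D12 f0 g0 fg; rewrite !ge0_integralE //.
apply: le_ereal_sup => _ [k kf <-]; exists k => // x.
apply: le_trans (kf x) _; rewrite /patch.
have [xD1|_] := boolP (x \in D1); last by case: ifP.
by rewrite ifT; [exact: fg (set_mem xD1)|exact/mem_set/D12/set_mem].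
Qed.

Lemma markov_nonmeasurable d (T : measurableType d) (R : realType)
    (mu : {measure set T -> \bar R}) (B : set T) (f : T -> \bar R) (r : R) :
  measurable B -> (0 <= r)%R -> (forall x, 0 <= f x) ->
  (forall x, B x -> r%:E <= f x) -> r%:E * mu B <= \int[mu]_x f x.
Proof.
move=> mB r0 f0 rf; rewrite -integral_cst //.
by apply: ge0_le_integral_nonmeasurable => // x; rewrite lee_fin.
Qed.

Lemma lebesgue_integral_rV_ge0 (R : realType) m (f : 'rV[R]_m -> \bar R) :
  (forall v, 0 <= f v) -> 0 <= lebesgue_integral_rV f.
Proof.
elim: m f => [|m IH] f f0 /=; first exact: f0.
by apply: integral_ge0 => x _; exact: IH.
Qed.

End LowerIntegral.

(** Induction on the dimension: slices whose first coordinate is farther than [r] from that of [c]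
    integrate to zero, and the others are bounded by induction, over an interval of length
    [2 * r]. *)
Lemma lebesgue_integral_rV_box (R : realType) m (f : 'rV[R]_m -> \bar R)
    (c : 'rV[R]_m) (r D : R) :
  (0 <= r) -> (0 <= D) -> (forall v, (0 <= f v <= D%:E)%E) ->
  (forall (v : 'rV[R]_m) i, (r < `|v 0 i - c 0 i|) -> f v = 0%E) ->
  (lebesgue_integral_rV f <= (D * (2 * r) ^+ m)%:E)%E.
Proof.
elim: m f c D => [|m IH] f c D r0 D0 fD f0 /=.
  by rewrite expr0 mulr1; have /andP[] := fD 0.
pose c0 := c 0 ord0; pose c' : 'rV[R]_m := \row_j c 0 (lift ord0 j).
pose J := `[c0 - r, c0 + r]%classic : set R.
have row0 x v : (row_mx (x%:M : 'M[R]_1) v) 0 ord0 = x.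
  by rewrite mxE; case: splitP => // j; rewrite ord1 => _; rewrite mxE mulr1n.
have rowS x v j : (row_mx (x%:M : 'M[R]_1) v) 0 (lift ord0 j) = v 0 j.
  rewrite mxE; case: splitP => [k|k /= []]; first by rewrite ord1.
  by move=> /val_inj ->.
apply: le_trans (_ : (\int[lebesgue_measure]_(x in J) (D * (2 * r) ^+ m)%:E <= _)%E);
  last first.
  rewrite integral_cst; last exact: measurable_itv.
  (* The length formula separates the degenerate interval, that is [r = 0], whose measure is 0. *)
  rewrite [X in (_ * X <= _)%E](lebesgue_measure_itv `[c0 - r, c0 + r]) /= lte_fin; case: ltP => _; last first.
    by rewrite mule0 lee_fin mulr_ge0 // exprn_ge0 // mulr_ge0.
  rewrite -EFinD -EFinM lee_fin exprSr mulrA.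
  by rewrite (_ : c0 + r - (c0 - r) = 2 * r) //; ring.
have DM : (0 <= D * (2 * r) ^+ m) by rewrite mulr_ge0 // exprn_ge0 // mulr_ge0.
rewrite [leRHS]integral_mkcond.
apply: ge0_le_integral_nonmeasurable => // x.
- apply: lebesgue_integral_rV_ge0 => v.
  by have /andP[] := fD (row_mx (x%:M : 'M[R]_1) v).
- by rewrite /patch; case: ifP; rewrite // lee_fin.
- move=> _; rewrite /patch; have [xJ|xJ] := boolP (x \in J).
    apply: (IH _ c') => // v i vi.
    by apply: (f0 _ (lift ord0 i)); rewrite rowS; move: vi; rewrite mxE.
  have z v : f (row_mx (x%:M : 'M[R]_1) v) = 0%E.
    apply: (f0 _ ord0); rewrite row0 ltNge; apply: contra xJ => xJ.
    by rewrite inE /J /= in_itv /= -ler_distlC distrC.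
  (* An outer slice vanishes identically, so the induction hypothesis applies with 0 in place of
     [D]. *)
  have := IH (fun v => f (row_mx (x%:M : 'M[R]_1) v)) c' 0 r0 (lexx _).
  by rewrite mul0r; apply=> v; rewrite z ?lexx.
Qed.

(** * The Riemannian form in a chart: continuity and local bounds *)

Lemma continuous_at_sum (K : numFieldType) (V : normedModType K)
    (T : topologicalType) (I : finType) (F : I -> T -> V) (x : T) :
  (forall i, {for x, continuous (F i)}) ->
  {for x, continuous (fun y => \sum_i F i y)}.
Proof.
move=> cF; apply: (@cvg_big V I +%R 0 xpredT _ T (nbhs x) (index_enum I) F) => //.
  exact: add_continuous.
by move=> i _; exact: cF.
Qed.

Section RiemannianForm.
Variables (R : realType) (n : nat) (X : ptopologicalType).
Variables (M : complexManifold R n X) (h : hermitianMetric M).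
Local Notation "x %:C" := (@real_complex R x : C R) : ring_scope.
Local Notation Rn := 'rV[R]_(n + n).

Lemma hformE (H : 'M[C R]_n) (u w : 'rV[C R]_n) :
  hform H u w = \sum_j (\sum_i u 0 i * H i j) * (w 0 j)^*.
Proof. by rewrite /hform mxE; apply: eq_bigr => j _; rewrite !mxE. Qed.

(** Conjugation fixes real scalars, so the sesquilinear form has a real bilinear real part,
    determined by its Gram matrix. Continuity in the base point and in the vectors thus reduces to
    finite sums. *)
Lemma riemannianE a x (v w : Rn) :
  riemannian h a x v w =
  \sum_i \sum_j v 0 i * w 0 j * gram h a x i j.
Proof.
have addl (v1 v2 w' : Rn) :
    riemannian h a x (v1 + v2) w' = riemannian h a x v1 w' + riemannian h a x v2 w'.
  by rewrite /riemannian /hform toCD !mulmxDl mxE raddfD.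
have addr (v' w1 w2 : Rn) :
    riemannian h a x v' (w1 + w2) = riemannian h a x v' w1 + riemannian h a x v' w2.
  by rewrite /riemannian /hform toCD linearD raddfD /= mulmxDr mxE raddfD.
have Re_scale (c : R) (z : C R) : complex.Re (c%:C * z) = c * complex.Re z.
  by case: z => p q /=; rewrite mul0r subr0.
have scalel (c : R) (v' w' : Rn) :
    riemannian h a x (c *: v') w' = c * riemannian h a x v' w'.
  by rewrite /riemannian /hform toCZ -!scalemxAl mxE Re_scale.
have scaler (c : R) (v' w' : Rn) :
    riemannian h a x v' (c *: w') = c * riemannian h a x v' w'.
  rewrite /riemannian !hformE toCZ -Re_scale mulr_sumr.
  congr complex.Re; apply: eq_bigr => j _; rewrite mxE rmorphM /= mulrCA.
  by congr (_ * _); apply/eqP; rewrite eq_complex /= oppr0 !eqxx.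
have zl (w' : Rn) : riemannian h a x 0 w' = 0.
  by rewrite -(scale0r 0) scalel mul0r.
have zr (v' : Rn) : riemannian h a x v' 0 = 0.
  by rewrite -(scale0r 0) scaler mul0r.
rewrite {1}(row_sum_delta v) (big_morph (fun u => riemannian h a x u w) (fun u1 u2 => addl u1 u2 w) (zl w)).
apply: eq_bigr => i _; rewrite scalel {1}(row_sum_delta w).
rewrite (big_morph (fun u => riemannian h a x _ u) (addr _) (zr _)).
by rewrite mulr_sumr; apply: eq_bigr => j _; rewrite scaler mxE mulrA.
Qed.

(** Smoothness of the metric is given for the real and imaginary parts of its entries, and this
    expansion is linear in them. *)
Lemma Re_hformE (H : 'M[C R]_n) (u w : 'rV[C R]_n) :
  complex.Re (hform H u w) =
  \sum_j \sum_i (complex.Re (u 0 i * (w 0 j)^*) * complex.Re (H i j)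
                 - complex.Im (u 0 i * (w 0 j)^*) * complex.Im (H i j)).
Proof.
rewrite hformE raddf_sum; apply: eq_bigr => j _.
rewrite mulr_suml raddf_sum; apply: eq_bigr => i _.
rewrite mulrAC; case: (u 0 i * _) => a b; case: (H i j) => c d //=.
Qed.

Lemma continuous_gram a (v : Rn) i j : rcodom a v ->
  {for v, continuous (fun w : Rn => gram h a (ricoord a w) i j)}.
Proof.
move=> av.
have e w : gram h a (ricoord a w) i j =
  complex.Re (hform (hmx h a (ricoord a w)) (toC (delta_mx 0 i : Rn)) (toC (delta_mx 0 j : Rn))).
  by rewrite mxE.
suff : {for v, continuous (fun w : Rn => complex.Re (hform
    (hmx h a (ricoord a w)) (toC (delta_mx 0 i : Rn)) (toC (delta_mx 0 j : Rn))))}.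
  by rewrite /prop_for /continuous_at e -(funext e).
rewrite /prop_for /continuous_at Re_hformE.
under eq_fun do rewrite Re_hformE.
apply: (@continuous_at_sum R R^o) => k; apply: (@continuous_at_sum R R^o) => l.
have [/(_ 0%N)[cRe _] /(_ 0%N)[cIm _]] := hmx_smooth h a l k.
by apply: continuousB; apply: continuousM; [exact: cst_continuous|exact: cRe|exact: cst_continuous|exact: cIm].
Qed.


Lemma continuous_det_gram a (v : Rn) : rcodom a v ->
  {for v, continuous (fun w : Rn => \det (gram h a (ricoord a w)))}.
Proof.
move=> av; apply: (@continuous_at_sum R R^o) => s.
apply: continuousM; first exact: cst_continuous.
apply: (@cvg_big R _ *%R 1 xpredT _ _ (nbhs v)) => [|i _].
  exact: mul_continuous.
exact: continuous_gram.
Qed.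

Lemma det_gram_bounded a (p : Rn) : rcodom a p ->
  exists2 D : R, 0 <= D &
    \forall w \near p, Num.sqrt (\det (gram h a (ricoord a w))) <= D.
Proof.
move=> ap; exists (Num.sqrt (\det (gram h a (ricoord a p)) + 1)) => //.
near=> w; apply: ler_wsqrtr; apply: ltW; rewrite -ltrBlDl.
near: w.
have := continuous_det_gram ap.
move/(@cvgr_distC_lt _ _ _ (nbhs p)) => /(_ 1 ltr01).
by apply: filterS => w; apply: le_lt_trans; exact: ler_norm.
Unshelve. all: by end_near. Qed.

Lemma riemannian_gt0 a x (v : Rn) : adom a x -> v != 0 ->
  0 < riemannian h a x v v.
Proof.
move=> ax v0; have Cv0 : toC v != 0.
  by apply: contra v0 => /eqP e; rewrite -(toCK v) e -toC0 toCK.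
by have := hmx_posdef h ax Cv0; rewrite ltcE => /andP[].
Qed.

(** At [p] the form has a positive minimum on the compact unit sphere, hence a quadratic lower bound
    by homogeneity. Moving the base point slightly changes the Gram entries so little that half of
    the bound survives. *)
Lemma riemannian_coercive a (p : Rn) : rcodom a p ->
  exists2 m : R, 0 < m & \forall w \near p, forall v : Rn,
    m * `|v| ^+ 2 <= riemannian h a (ricoord a w) v v.
Proof.
move=> ap.
pose S : set Rn := [set v | `|v| = 1].
have [m m0 mS] : exists2 m : R, 0 < m &
    forall v, S v -> m <= riemannian h a (ricoord a p) v v.
  (* For [n = 0] the unit sphere is empty and any positive [m] will do. *)
  have [S0|S0] := pselect (S !=set0); last first.
    by exists 1 => // v Sv; exfalso; apply: S0; exists v.
  have cS : compact S.
    apply: bounded_closed_compact.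
      by exists 1; split=> // r r1 v /= ->; exact: ltW.
    apply: (@preimage_closed Rn R (fun v => `|v|) [set r | r = 1]) => [v _|].
      exact: norm_continuous.
    exact: closed_eq.
  have cq : {within S, continuous (fun v : Rn => riemannian h a (ricoord a p) v v)}.
    apply: continuous_subspaceT => v.
    under eq_fun do rewrite riemannianE.
    apply: (@continuous_at_sum R R^o) => i; apply: (@continuous_at_sum R R^o) => j.
    apply: continuousM; last exact: cst_continuous.
    by apply: continuousM; exact: coord_continuous.
  have [u uS um] := EVT_min_rV S0 cS cq.
  exists (riemannian h a (ricoord a p) u u); last by move=> v /mem_set; exact: um.
  apply: riemannian_gt0; last by rewrite -normr_eq0 (set_mem uS) oner_eq0.
  by case: ap => x ax <-; rewrite /ricoord toRK coordK.
have {}mS v : m * `|v| ^+ 2 <= riemannian h a (ricoord a p) v v.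
  have [->|v0] := eqVneq v 0.
    rewrite normr0 expr0n mulr0 riemannianE sumr_ge0 // => i _.
    by rewrite sumr_ge0 // => j _; rewrite mxE !mul0r.
  have /mS : S (`|v|^-1 *: v) by rewrite /S /= normrZ normfV normr_id mulVf ?normr_eq0.
  rewrite -(ler_pM2r (_ : 0 < `|v| ^+ 2)) ?exprn_gt0 ?normr_gt0 //.
  move=> /le_trans; apply; rewrite le_eqVlt !riemannianE mulr_suml; apply/orP; left.
  apply/eqP; apply: eq_bigr => i _; rewrite mulr_suml; apply: eq_bigr => j _.
  by rewrite !mxE; field; rewrite normr_eq0.
(* The form is a sum over [(n + n) ^ 2] Gram entries, each allowed an error [m / 2 / N]; the added 1
   keeps [N] positive when [n = 0]. *)
pose N : R := (n + n)%:R ^+ 2 + 1.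
have N0 : 0 < N by rewrite ltr_wpDl // exprn_ge0.
exists (m / 2); first by rewrite divr_gt0.
have e0 : 0 < m / 2 / N by rewrite !divr_gt0.
have near_gram : \forall w \near p, forall ij : 'I_(n + n) * 'I_(n + n),
    `|gram h a (ricoord a p) ij.1 ij.2 - gram h a (ricoord a w) ij.1 ij.2| <= m / 2 / N.
  apply: (@filter_forall _ _ (fun ij w => `|gram h a (ricoord a p) ij.1 ij.2 -
    gram h a (ricoord a w) ij.1 ij.2| <= m / 2 / N) (nbhs p) _) => -[i j] /=.
  have := @continuous_gram a p i j ap.
  by move/(@cvgr_dist_le _ _ _ (nbhs p)); apply.
apply: filterS near_gram => w Gw v.
have : riemannian h a (ricoord a p) v v - riemannian h a (ricoord a w) v v
    <= m / 2 * `|v| ^+ 2.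
  rewrite !riemannianE -sumrB.
  apply: le_trans (_ : \sum_(i < n + n) \sum_(j < n + n) (m / 2 / N * `|v| ^+ 2) <= _).
    apply: ler_sum => i _; rewrite -sumrB; apply: ler_sum => j _.
    rewrite -mulrBr; apply: le_trans (ler_norm _) _; rewrite normrM mulrC.
    apply: ler_pM => //; first exact: (Gw (i, j)).
    by rewrite normrM expr2; apply: ler_pM => //; exact: normr_mx_entry.
  rewrite !sumr_const card_ord -mulrnA -[leLHS]mulr_natl mulrA natrM -expr2.
  rewrite ler_wpM2r ?exprn_ge0 // mulrA ler_pdivrMr // mulrC.
  by rewrite ler_wpM2l ?divr_ge0 ?ltW // /N ltrDl.
rewrite lerBlDl -lerBlDr => /(le_trans _); apply.
rewrite lerBrDr -mulrDl -splitr; exact: mS.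
Qed.

End RiemannianForm.

(** * Velocity and speed of a curve under a change of chart *)

Lemma cvg_derive1 (R : numFieldType) (V : normedModType R) (f : R -> V) (t : R) :
  derivable f t 1 -> e^-1 *: (f (e + t) - f t) @[e --> 0^'] --> derive1 f t.
Proof.
move=> df; rewrite /derive1.
have -> : (fun e => e^-1 *: (f (e + t) - f t)) =
    (fun e => e^-1 *: ((f \o shift t) (e *: 1) - f t)).
  by apply/funext => e /=; rewrite [e%:A]mulr1.
exact: df.
Qed.

Section ChangeOfChart.
Variables (R : realType) (n : nat) (X : ptopologicalType).
Variables (M : complexManifold R n X) (h : hermitianMetric M).
Local Notation "x %:C" := (@real_complex R x : C R) : ring_scope.
Local Notation Rn := 'rV[R]_(n + n).

Lemma toC_rcoord (a : aindex M) x : toC (rcoord a x) = Defs.coord (atlas a) x.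
Proof. exact: toRK. Qed.

Lemma rcoordK (a : aindex M) x : adom a x -> ricoord a (rcoord a x) = x.
Proof. by move=> ax; rewrite /ricoord toC_rcoord coordK. Qed.

Lemma rcoord_continuous (a : aindex M) x : adom a x ->
  {for x, continuous (rcoord a)}.
Proof.
move=> ax; apply: (@continuous_comp _ _ _ (Defs.coord (atlas a)) (@toR R n)).
  exact: Defs.coord_continuous ax.
exact: toR_continuous.
Qed.

Lemma near_adom (a : aindex M) x : adom a x -> \forall y \near x, adom a y.
Proof. by move=> ax; exact: open_nbhs_nbhs (conj (cdom_open _) ax). Qed.

(** A chain rule mixing two fields: the transition map is differentiable over [C R], the curve over
    [R]. The difference quotients in chart [b] converge both to the velocity there and to the image
    of the velocity in [a], so uniqueness of limits concludes. *)
Lemma derive1_rcoord_transition (g : R -> X) (t : R) (a b : aindex M) :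
  {for t, continuous g} -> adom a (g t) -> adom b (g t) ->
  derivable (rcoord a \o g) t 1 -> derivable (rcoord b \o g) t 1 ->
  toC (derive1 (rcoord b \o g) t) =
  dtransition a b (g t) (toC (derive1 (rcoord a \o g) t)).
Proof.
move=> cg ax bx dga dgb.
pose F := Defs.coord (atlas b) \o icoord (atlas a); pose z := Defs.coord (atlas a) (g t).
have [cL FL] := (diff_locallyxP z F).1 (atlas_holomorphic ax bx).
set L := 'd F z in cL FL.
have FLo (eps : C R) : 0 < eps -> \forall u \near (0 : 'rV[C R]_n),
    `|F (u + z) - (F z + L u)| <= eps * `|u|.
  by move/eqaddoP: (funext FL); exact.
pose q (c : aindex M) (e : R) : Rn :=
  e^-1 *: (rcoord c (g (e + t)) - rcoord c (g t)).
have qa : q a e @[e --> 0^'] --> derive1 (rcoord a \o g) t := cvg_derive1 dga.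
have qb : q b e @[e --> 0^'] --> derive1 (rcoord b \o g) t := cvg_derive1 dgb.
have cvgC (u : R -> Rn) (l : Rn) : u e @[e --> 0^'] --> l ->
    toC (u e) @[e --> 0^'] --> toC l.
  by move=> ul; apply: (@cvg_comp _ _ _ u (@toC R n)) ul _; exact: toC_continuous.
apply: (@cvg_unique _ (@norm_hausdorff _ _) (toC (q b e) @[e --> 0^'])).
  exact: cvgC.
have cvgL : L (toC (q a e)) @[e --> 0^'] --> L (toC (derive1 (rcoord a \o g) t)).
  by apply: (@cvg_comp _ _ _ (fun e => toC (q a e)) L) (cvgC _ _ qa) _; exact: cL.
(* [H e] is the increment of the complex coordinates in chart [a]; it tends to 0, so the first-order
   expansion of [F] at [z] applies to it. *)
pose H (e : R) := Defs.coord (atlas a) (g (e + t)) - z.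
have gcvg : g (e + t) @[e --> 0^'] --> g t.
  have et : e + t @[e --> 0^'] --> t.
    rewrite -{2}(add0r t); apply: cvgD; last exact: cvg_cst.
    exact: cvg_within.
  exact: (@cvg_comp _ _ _ (fun e => e + t) g) et cg.
have H0 : H e @[e --> 0^'] --> (0 : 'rV[C R]_n).
  rewrite -(subrr z); apply: cvgB; last exact: cvg_cst.
  exact: cvg_comp gcvg (Defs.coord_continuous ax).
have HE (e : R) : e != 0 -> H e = e%:C *: toC (q a e).
  by move=> e0; rewrite /q -toCZ scalerA divff // scale1r toCB !toC_rcoord.
(* This is the expansion error at [H e] divided by [e]. For small [e] the curve is still in both
   chart domains, where [F] takes its coordinates in [a] to those in [b]. *)
have oH (eps : R) : 0 < eps -> \forall e \near 0^',
    `|toC (q b e) - L (toC (q a e))| <= eps%:C * `|toC (q a e)|.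
  move=> eps0.
  have epsC0 : (0 : C R) < eps%:C by rewrite ltcR.
  have small := H0 _ (FLo _ epsC0).
  near=> s.
  have s_neq0 : s != 0 by near: s; exact: nbhs_dnbhs_neq.
  have sC_neq0 : s%:C != 0 by apply: contra s_neq0 => /eqP[->].
  have cga : adom a (g (s + t)) by near: s; apply: gcvg; exact: near_adom.
  have cgb : adom b (g (s + t)) by near: s; apply: gcvg; exact: near_adom.
  have qbE : toC (q b s) = s%:C^-1 *: (F (H s + z) - F z).
    rewrite /q /F /H subrK /= !coordK // toCZ toCB !toC_rcoord.
    by rewrite fmorphV.
  have LE : L (toC (q a s)) = s%:C^-1 *: L (H s).
    by rewrite HE // linearZ /= scalerA mulVf // scale1r.
  rewrite qbE LE -scalerBr -addrA -opprD.
  rewrite normrZ normfV ler_pdivrMl ?normr_gt0 // mulrCA -normrZ -HE //.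
  by near: s.
set va := derive1 _ t in qa cvgL *.
(* [K] eventually bounds the norm of [toC (q a e)]: the real quotient comes within 1 of its limit
   [va], and [norm_toC] costs a factor 2. *)
pose K : R := 2 * (`|va| + 1).
have K0 : 0 < K by rewrite mulr_gt0 // ltr_wpDl.
rewrite -[dtransition _ _ _ _]/(L (toC va)).
apply/(@cvgrPdist_lt _ _ _ (0^')) => _ /posC_real[eps eps0 ->].
have eps20 : 0 < eps / 2 by rewrite divr_gt0.
have near_o := oH _ (divr_gt0 eps20 K0).
have near_L := (@cvgrPdist_lt _ _ _ (0^') _ _ _).1 cvgL (eps / 2)%:C.
rewrite ltcR in near_L; have {}near_L := near_L _ eps20.
have near_q : \forall e \near 0^', `|q a e| <= `|va| + 1.
  have := (@cvgrPdist_le _ _ _ (0^') _ _ _).1 qa 1.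
  move=> /(_ _ ltr01); apply: filterS => e; rewrite distrC => qe; rewrite -(subrK va (q a e)) addrC.
  by apply: le_trans (ler_normD _ _) _; rewrite lerD2l.
near=> s.
rewrite -(subrK (L (toC (q a s))) (L (toC va))) -addrA.
apply: le_lt_trans (ler_normD _ _) _.
rewrite (splitr eps) rmorphD /=; apply: ltr_leD; first by near: s; exact: near_L.
rewrite distrC; apply: (@le_trans _ _ ((eps / 2 / K)%:C * `|toC (q a s)|)).
  by near: s.
apply: (@le_trans _ _ ((eps / 2 / K)%:C * K%:C)); last first.
  by rewrite -rmorphM /= divfK ?gt_eqF.
rewrite ler_pM2l ?ltcR ?divr_gt0 //; apply: le_trans (norm_toC _) _.
rewrite lecR /K ler_pM2l //.
by near: s.
Unshelve. all: by end_near. Qed.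


(** Velocities in two charts correspond under the differential of the transition, which [hmx_compat]
    makes an isometry; so the chart chosen in [speed] is immaterial. *)
Lemma speed_chart (g : R -> X) (t : R) (a : aindex M) :
  C1_curve M g -> adom a (g t) ->
  speed h g t = Num.sqrt (riemannian h a (g t) (derive1 (rcoord a \o g) t)
                                             (derive1 (rcoord a \o g) t)).
Proof.
move=> [cg dg] ax; rewrite /speed; set b := chart_at M (g t).
have bx : adom b (g t) by exact: projT2 (cid (atlas_cover M (g t))).
have d (c : aindex M) : adom c (g t) -> derivable (rcoord c \o g) t 1.
  by move=> cx; have [/nbhs_singleton] := dg _ _ cx.
have E := derive1_rcoord_transition (cg t) ax bx (d _ ax) (d _ bx).
by rewrite /riemannian E -(hmx_compat h ax bx).
Qed.

End ChangeOfChart.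

(** * Length of curves leaving a coordinate ball *)

Section LengthLowerBound.
Variables (R : realType) (n : nat) (X : ptopologicalType).
Hypothesis X_hausdorff : hausdorff_space X.
Variables (M : complexManifold R n X) (h : hermitianMetric M).
Local Notation Rn := 'rV[R]_(n + n).

Definition chart_ball (a : aindex M) (c : Rn) (r : R) : set X :=
  [set z | adom a z /\ `|rcoord a z - c| <= r].

Definition chart_open_ball (a : aindex M) (c : Rn) (r : R) : set X :=
  [set z | adom a z /\ `|rcoord a z - c| < r].

Lemma chart_open_ball_open a c r : open (chart_open_ball a c r).
Proof.
rewrite openE => z [az zr]; near=> y; split; first by near: y; exact: near_adom.
near: y; have /(@cvgr_lt _ _ _ _ _ (`|rcoord a z - c|)) : 
    `|rcoord a y - c| @[y --> z] --> `|rcoord a z - c|.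
  apply: cvg_norm; apply: cvgB; last exact: cvg_cst.
  exact: rcoord_continuous.
exact.
Unshelve. all: by end_near. Qed.

(** The set is the image of a compact ball under the continuous inverse chart, hence compact, hence
    closed in the Hausdorff space [X]. *)
Lemma chart_ball_closed a c r :
  (forall w, `|w - c| <= r -> rcodom a w) -> closed (chart_ball a c r).
Proof.
move=> cr; pose B : set Rn := [set w | `|w - c| <= r].
have -> : chart_ball a c r = ricoord a @` B.
  apply/seteqP; split=> [z [az zr]|_ [w Bw <-]].
    by exists (rcoord a z) => //; rewrite rcoordK.
  by have [x ax xw] := cr w Bw; split; rewrite -xw rcoordK // xw.
apply: compact_closed => //; apply: continuous_compact.
  apply: continuous_in_subspaceT => w /set_mem Bw.
  apply: continuous_comp; first exact: toC_continuous.
  by apply: icoord_continuous; have [x ax <-] := cr w Bw; rewrite toC_rcoord; exists x.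
apply: bounded_closed_compact.
  exists (r + `|c|); split=> [|s rs w Bw /=]; first exact: num_real.
  apply: ltW; apply: le_lt_trans rs; rewrite -(subrK c w).
  by apply: le_trans (ler_normD _ _) _; rewrite lerD2r.
apply: (@preimage_closed Rn R (fun w => `|w - c|) [set s | s <= r]) => [w _|].
  apply: (@cvg_norm _ Rn _ (nbhs w) _ (fun u => u - c));
  apply: cvgB; [exact: cvg_id|exact: cvg_cst].
exact: closed_le.
Qed.

(** [T] is the first time outside the open ball; it exists because such times form a nonempty
    compact subset of [[0, 1]]. *)
Lemma exit_time (g : R -> X) a c r : continuous g ->
  (forall w, `|w - c| <= r -> rcodom a w) ->
  chart_open_ball a c r (g 0) -> ~ chart_ball a c r (g 1) ->
  exists T : R, [/\ 0 < T <= 1, r <= `|rcoord a (g T) - c| &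
    forall t, 0 <= t <= T -> chart_ball a c r (g t)].
Proof.
move=> cg cr g0 g1; pose O := chart_open_ball a c r.
have OU : O `<=` chart_ball a c r by move=> z [az zr]; split=> //; exact: ltW.
pose S : set R := `[0, 1] `&` [set t | ~ O (g t)].
have cS : compact S.
  apply: compact_closedI; first exact: segment_compact.
  apply: (@preimage_closed _ _ g (~` O)) => [t _|]; first exact: cg.
  by rewrite closedC; exact: chart_open_ball_open.
have S1 : S !=set0 by exists 1; split=> [|/OU //]; rewrite /= in_itv /= ler01 lexx.
have [T /set_mem[+ gT] minT] :=
  compact_EVT_min S1 cS (@continuous_subspaceT _ _ S id (fun x => cvg_id)).
rewrite /= in_itv /= => /andP[T0 T1].
have {}T0 : 0 < T by rewrite lt_neqAle T0 andbT; apply/eqP => e; apply: gT; rewrite -e.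
have before t : 0 <= t < T -> O (g t).
  move=> /andP[t0 tT]; apply: contrapT => gt.
  have := minT t; rewrite leNgt tT => /(_ _)/negP; case=> //.
  by rewrite inE; split=> //; rewrite /= in_itv /= t0 (le_trans (ltW tT)).
(* If [g T] were outside the closed ball, so would be [g t] for [t] slightly below [T], although
   these points lie in the open ball. *)
have KT : chart_ball a c r (g T).
  apply: contrapT => gKT.
  have nK : \forall t \near T^'-, ~ chart_ball a c r (g t).
    suff : \forall z \near g T, ~ chart_ball a c r z.
      exact: (cvg_at_left_filter (cg T)).
    apply: open_nbhs_nbhs; split=> //.
    by rewrite openC; exact: chart_ball_closed.
  have tT : \forall t \near T^'-, 0 <= t < T.
    near=> t; apply/andP; split; last by near: t; exact: nbhs_left_lt.
    by near: t; exact: nbhs_left_ge.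
  have := @filter_ex _ (T^'-) _ _ (filterI nK tT).
  by case=> t [Kt /before/OU Ut]; exact: Kt.
exists T; split; first by rewrite T0.
  by rewrite leNgt; apply/negP => lt; apply: gT; case: KT.
move=> t /andP[t0]; rewrite le_eqVlt => /predU1P[-> //|tT].
by apply/OU/before; rewrite t0.
Unshelve. all: by end_near. Qed.

(** Only the part of the curve up to the exit time is measured. It stays in the chart, where the
    speed is at least [m] times the norm of the coordinate velocity. *)
Lemma curve_length_ge (g : R -> X) a r m : C1_curve M g -> 0 < r -> 0 <= m ->
  adom a (g 0) ->
  (forall w, `|w - rcoord a (g 0)| <= r -> rcodom a w /\
    forall v, m ^+ 2 * `|v| ^+ 2 <= riemannian h a (ricoord a w) v v) ->
  ~ chart_ball a (rcoord a (g 0)) r (g 1) ->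
  ((m * r)%:E <= curve_length h g)%E.
Proof.
move=> Cg r0 m0 ag0 cr g1; have [cg dg] := Cg; set c := rcoord a (g 0) in cr g1 *.
have [||T [/andP[T0 T1] rT gT]] := exit_time cg _ _ g1.
- by move=> w /cr[].
- by split=> //; rewrite subrr normr0.
pose G := rcoord a \o g.
(* In the sup norm a single coordinate already moves by [r], so the scalar fundamental theorem of
   calculus suffices. *)
have [i ri] : exists i, r <= `|G T 0 i - G 0 0 i|.
  apply: contrapT => /forallNP all_lt; move: rT; apply/negP; rewrite -ltNge.
  apply: normr_mx_lt => // k i; rewrite ord1 ltNge; apply/negP => ri.
  by apply: (all_lt i); move: ri; rewrite mxE [(- c) 0 i]mxE.
have aT t : 0 <= t <= T -> adom a (g t) by move=> /gT[].
have dG t : 0 <= t <= T -> derivable G t 1.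
  by move=> /aT /dg[near_d _]; exact: nbhs_singleton near_d.
pose F t := G t 0 i; pose f t := (derive1 G t) 0 i.
have dF t : 0 <= t <= T -> derivable F t 1.
  by move=> /dG /derivable_mxP/(_ 0 i).
have cF t : 0 <= t <= T -> {for t, continuous F}.
  by move=> /dF /derivable1_diffP; exact: differentiable_continuous.
have F'f t : 0 <= t <= T -> derive1 F t = f t.
  by move=> /dG d; rewrite /f !derive1E derive_mx // mxE.
have cf t : 0 <= t <= T -> {for t, continuous f}.
  move=> /aT at_; have [_ c'] := dg _ _ at_.
  by apply: (@continuous_comp _ _ _ (derive1 G) (fun v : Rn => v 0 i)) => //; exact: coord_continuous.
have cwf : {within `[0, T], continuous f}.
  by apply: continuous_in_subspaceT => t; rewrite inE /= in_itv /=; exact: cf.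
have FTC : (\int[lebesgue_measure]_(x in `[0%R, T]) (f x)%:E = (F T)%:E - (F 0%R)%:E)%E.
  apply: continuous_FTC2 => //.
    split.
    - by move=> t; rewrite in_itv /= => /andP[/ltW t0 /ltW tT]; apply: dF; rewrite t0.
    - by apply: cvg_at_right_filter; apply: cF; rewrite lexx ltW.
    - by apply: cvg_at_left_filter; apply: cF; rewrite lexx ltW.
  by move=> t; rewrite in_itv /= => /andP[/ltW t0 /ltW tT]; apply: F'f; rewrite t0.
have mf : measurable_fun `[0, T] f.
  by apply: measurable_realfun.subspace_continuous_measurable_fun => //; exact: measurable_itv.
have rf : (r%:E <= \int[lebesgue_measure]_(x in `[0%R, T]) `|f x|%:E)%E.
  apply: (@le_trans _ _ `|(F T)%:E - (F 0)%:E|%E); first by rewrite lee_fin.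
  by rewrite -FTC; apply: le_abse_integral => //; exact/measurable_realfun.measurable_EFinP.
(* The factor [m] is pulled out of the integral of the continuous [f], before the comparison with
   the speed, for which only monotonicity is used. *)
apply: (@le_trans _ _ (\int[lebesgue_measure]_(x in `[0%R, T]) (m%:E * `|f x|%:E))%E).
  rewrite ge0_integralZl_EFin //; last exact/measurable_realfun.measurable_EFinP/measurableT_comp.
  by rewrite EFinM lee_wpmul2l // lee_fin.
apply: ge0_le_integral_nonmeasurable => [t|t|t|t].
- by rewrite /= !in_itv /= => /andP[-> tT] /=; exact: le_trans T1.
- by rewrite -EFinM lee_fin mulr_ge0.
- by rewrite lee_fin sqrtr_ge0.
rewrite /= in_itv /= => tT.
rewrite -EFinM lee_fin (speed_chart h Cg (aT _ tT)).
have [_ /cr[_ /(_ (derive1 G t))]] := gT _ tT; rewrite rcoordK; last exact: aT.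
move=> /ler_wsqrtr; apply: le_trans.
by rewrite -exprMn sqrtr_sqr normrM normr_id ger0_norm // ler_wpM2l // normr_mx_entry.
Qed.

Lemma hdist_ge0 x y : (0 <= hdist h x y)%E.
Proof.
apply: le_ereal_inf_tmp => _ [g _ <-].
by apply: integral_ge0 => t _; rewrite lee_fin sqrtr_ge0.
Qed.

Lemma hdist_ge a x y r m : 0 < r -> 0 <= m -> adom a x ->
  (forall w, `|w - rcoord a x| <= r -> rcodom a w /\
    forall v, m ^+ 2 * `|v| ^+ 2 <= riemannian h a (ricoord a w) v v) ->
  ~ chart_ball a (rcoord a x) r y -> ((m * r)%:E <= hdist h x y)%E.
Proof.
move=> r0 m0 ax cr xy; apply: le_ereal_inf_tmp => _ [g [Cg g0 g1] <-].
by apply: (@curve_length_ge g a) => //; rewrite ?g0 ?g1.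
Qed.

End LengthLowerBound.

(** * Mass and distance estimates for small coordinate balls *)

Lemma closed_borel (X : ptopologicalType) (A : set X) :
  closed A -> measurable (A : set (borel X)).
Proof.
move=> cA; rewrite -[A]setCK; apply: measurableC.
by apply: sub_sigma_algebra; exact: closed_openC.
Qed.

Section BallEstimates.
Variables (R : realType) (n : nat) (X : ptopologicalType).
Hypothesis X_hausdorff : hausdorff_space X.
Variables (M : complexManifold R n X) (h : hermitianMetric M).
Variable sigma : probability (borel X) R.
Local Notation Rn := 'rV[R]_(n + n).

Lemma rcodom_near (a : aindex M) (p : Rn) : rcodom a p ->
  \forall w \near p, rcodom a w.
Proof.
move=> [x ax <-].
have : \forall w \near rcoord a x, (Defs.coord (atlas a) @` adom a) (toC w).
  apply: (@toC_continuous R n (rcoord a x)); rewrite toC_rcoord.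
  by apply: open_nbhs_nbhs; split; [exact: image_open|exists x].
by apply: filterS => w [z az zw]; exists z; rewrite // /rcoord zw toCK.
Qed.

(** The density is at most [B], the volume factor at most [D], and a sup-norm ball is a cube of side
    [2 * r]. *)
Lemma sigma_chart_ball_le (vol : {measure set (borel X) -> \bar R})
    (f : X -> R) (a : aindex M) (c : Rn) (r B D : R) :
  riemannian_volume h vol -> (forall x, 0 < f x) ->
  (forall A : set (borel X), measurable A ->
    sigma A = (\int[vol]_(x in A) (f x)%:E)%E) ->
  0 <= r -> 0 <= B -> 0 <= D ->
  (forall w, `|w - c| <= r -> [/\ rcodom a w, f (ricoord a w) <= B &
    Num.sqrt (\det (gram h a (ricoord a w))) <= D]) ->
  (sigma (chart_ball a c r) <= (B * (D * (2 * r) ^+ (n + n)))%:E)%E.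
Proof.
move=> volE f0 sigmaE r0 B0 D0 cr; set U := chart_ball a c r.
have mU : measurable (U : set (borel X)).
  by apply: closed_borel; apply: chart_ball_closed => // w /cr[].
rewrite sigmaE //; apply: (@le_trans _ _ (\int[vol]_(x in U) B%:E)%E).
  apply: ge0_le_integral_nonmeasurable => // x; rewrite lee_fin; first exact: ltW.
  by move=> [ax xr]; have [_ + _] := cr _ xr; rewrite rcoordK.
rewrite integral_cst // EFinM lee_wpmul2l ?lee_fin // (volE a) //; last first.
  by move=> x [].
apply: (@lebesgue_integral_rV_box _ _ _ c) => // [v|v i vi].
  rewrite !lee_fin mulr_ge0 //=; have [vU|vU] := boolP (v \in rcoord a @` U).
    have [x [ax xr] xv] := set_mem vU.
    by rewrite indicE vU mul1r -xv; have [] := cr _ xr.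
  by rewrite indicE (negbTE vU) mul0r.
rewrite indicE memNset ?mul0r // => -[x [ax xr] xv].
move: vi; rewrite ltNge => /negP; apply; apply: le_trans xr; rewrite xv.
by have := normr_mx_entry (v - c) 0 i; rewrite mxE [(- c) 0 i]mxE.
Qed.

(* The same constant [e] bounds the admissible radii, the inverse of the volume
   constant and the distance constant, so that the property is inherited by
   smaller values of [e] and can be made uniform by compactness. *)
Definition ball_estimate (e : R) (x : X) : Prop :=
  forall r, 0 < r <= e -> exists U : set (borel X), [/\ measurable U,
    (sigma U <= (e^-1 * r ^+ (n + n))%:E)%E &
    forall z, ~ U z -> ((e * r)%:E <= hdist h x z)%E].

(** One chart at [x] serves all nearby centres: the local bounds hold within [r0] of [p], and both
    the offset of the centre and the radius are kept to [r0 / 2]. *)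
Lemma ball_estimate_near (x : X) : nowhere_vanishing_smooth h sigma ->
  \forall y \near x & e \near 0^'+, ball_estimate e y.
Proof.
move=> [vol [f [volE sf f0 sigmaE]]].
pose a := chart_at M x.
have ax : adom a x by exact: projT2 (cid (atlas_cover M x)).
pose p := rcoord a x.
have ap : rcodom a p by exists x.
have [m m0 near_m] := riemannian_coercive h ap.
have [D D0 near_D] := det_gram_bounded h ap.
pose B := f x + 1.
have B0 : 0 <= B by rewrite addr_ge0 // ltW.
have near_B : \forall w \near p, f (ricoord a w) <= B.
  have [cf _] := sf a 0%N.
  have /(@cvgr_distC_lt _ _ _ (nbhs p)) /(_ 1 ltr01) := cf p ap.
  rewrite /= rcoordK //; apply: filterS => w fw; apply: ltW.
  by rewrite /B addrC -ltrBlDr; exact: le_lt_trans (ler_norm _) fw.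
have near_p : \forall w \near p, [/\ rcodom a w, f (ricoord a w) <= B,
    Num.sqrt (\det (gram h a (ricoord a w))) <= D &
    forall v, m * `|v| ^+ 2 <= riemannian h a (ricoord a w) v v].
  by near=> w; split; near: w => //; exact: rcodom_near.
have [r0 /= r00 ball_r0] : exists2 r : R, 0 < r & forall w, `|p - w| < r ->
    [/\ rcodom a w, f (ricoord a w) <= B,
      Num.sqrt (\det (gram h a (ricoord a w))) <= D &
      forall v, m * `|v| ^+ 2 <= riemannian h a (ricoord a w) v v].
  have /nbhs_ballP[r r_gt0 pr] := near_p.
  by exists r => // w pw; apply: pr; rewrite -ball_normE.
have r2 : 0 < r0 / 2 by rewrite divr_gt0.
(* This is the volume constant of the ball, increased by 1 to be positive and so invertible. *)
have K0 : 0 < B * (D * 2 ^+ (n + n)) + 1.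
  by rewrite ltr_wpDl // !mulr_ge0.
near=> y e => /= r /andP[r_gt0 re].
have e0 : 0 < e by near: e; exact: nbhs_right_gt.
have er0 : e <= r0 / 2 by near: e; exact: nbhs_right_le.
have em : e <= Num.sqrt m by near: e; apply: nbhs_right_le; rewrite sqrtr_gt0.
have eK : e <= (B * (D * 2 ^+ (n + n)) + 1)^-1.
  by near: e; apply: nbhs_right_le; rewrite invr_gt0.
have ay : adom a y by near: y; exact: near_adom.
have yp : `|p - rcoord a y| < r0 / 2.
  near: y; have := rcoord_continuous ax.
  by move/(@cvgr_dist_lt _ _ _ (nbhs x)); apply.
have good w : `|w - rcoord a y| <= r -> `|p - w| < r0.
  move=> wr; rewrite -(subrK (rcoord a y) p) -addrA (splitr r0).
  apply: le_lt_trans (ler_normD _ _) _; apply: ltr_leD => //.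
  by rewrite distrC (le_trans wr) // (le_trans re).
exists (chart_ball a (rcoord a y) r); split.
- by apply: closed_borel; apply: chart_ball_closed => // w /good/ball_r0[].
- apply: le_trans (sigma_chart_ball_le volE f0 sigmaE (ltW r_gt0) B0 D0 _) _.
    by move=> w /good/ball_r0[].
  have Ke : B * (D * 2 ^+ (n + n)) + 1 <= e^-1.
    by rewrite -[leLHS]invrK lef_pV2 ?posrE ?invr_gt0.
  rewrite lee_fin exprMn 2!mulrA ler_wpM2r ?exprn_ge0 ?(ltW r_gt0) //.
  by rewrite -mulrA; apply: le_trans Ke; rewrite lerDl.
- move=> z Uz; apply: (@le_trans _ _ (Num.sqrt m * r)%:E).
    by rewrite lee_fin ler_pM2r.
  apply: (@hdist_ge R n X X_hausdorff M h a y z r (Num.sqrt m)) => // w /good/ball_r0[aw _ _ mw]; split=> // v.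
  by rewrite sqr_sqrtr // ltW.
Unshelve. all: by end_near. Qed.

(** Compactness as the near-covering property: estimates valid near each point for all small [e]
    share one [e] on all of [X]. *)
Lemma uniform_ball_estimate : compact [set: X] ->
  nowhere_vanishing_smooth h sigma ->
  exists2 e : R, 0 < e <= 1 & forall x, ball_estimate e x.
Proof.
move=> /compact_near_coveringP X_compact sigma_smooth.
have near_e := X_compact _ (0^'+) ball_estimate _
  (fun x _ => ball_estimate_near x sigma_smooth).
have near_01 : \forall e \near (0 : R)^'+, 0 < e <= 1.
  near=> e; apply/andP; split; first by near: e; exact: nbhs_right_gt.
  by near: e; apply: nbhs_right_le.
have := @filter_ex _ ((0 : R)^'+) _ _ (filterI near_01 (near_e _)).
by case=> e [e01 good]; exists e => // x; exact: good.
Unshelve. all: by end_near. Qed.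

End BallEstimates.

(** * From ball estimates to the Wasserstein distance *)

Lemma measure_bigsetU_le d (T : measurableType d) (R : realType)
    (mu : {measure set T -> \bar R}) (I : Type) (s : seq I) (U : I -> set T)
    (K : R) :
  (forall i, measurable (U i)) -> (forall i, (mu (U i) <= K%:E)%E) ->
  measurable (\big[setU/set0]_(i <- s) U i) /\
  (mu (\big[setU/set0]_(i <- s) U i) <= ((size s)%:R * K)%:E)%E.
Proof.
move=> mU muU; elim: s => [|i s [mUs muUs]].
  by rewrite big_nil measure0 mul0r.
rewrite big_cons; split; first exact: measurableU.
apply: le_trans (measureU2 _ _ _) _ => //.
by rewrite /= mulrS mulrDl mul1r EFinD; exact: leeD.
Qed.

Section WassersteinLowerBound.
Variables (R : realType) (X : ptopologicalType).
Hypothesis X_hausdorff : hausdorff_space X.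

Lemma fset_borel (E : {fset X}) : measurable ([set` E] : set (borel X)).
Proof.
apply: closed_borel; apply: accessible_finite_set_closed.1 _ _ _.
  exact: hausdorff_accessible.
exact: finite_fset.
Qed.

Lemma empirical_measure_setC (E : {fset X}) (mu : probability (borel X) R) :
  empirical_measure E mu -> mu (~` [set` E]) = 0%E.
Proof.
move=> /(_ _ (measurableC (fset_borel E))) ->.
rewrite big_seq big1 ?mule0 // => x xE.
by rewrite diracE memNset // => /(_ xE).
Qed.

(** Every coupling gives mass at least [t] to pairs starting in [A] and ending outside [B], and each
    such pair costs at least [r]; the Markov inequality concludes. *)
Lemma wasserstein_ge (d : X -> X -> \bar R) (mu nu : probability (borel X) R)
    (A B : set (borel X)) (r t : R) :
  (forall x y, 0 <= d x y)%E -> 0 <= r -> measurable A -> measurable B ->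
  mu (~` A) = 0%E -> (nu B <= (1 - t)%:E)%E ->
  (forall x y, A x -> ~ B y -> (r%:E <= d x y)%E) ->
  ((r * t)%:E <= wasserstein d mu nu)%E.
Proof.
move=> d0 r0 mA mB muA nuB dr; apply: le_ereal_inf_tmp => _ [rho rhoE <-].
have mAB : measurable (A `*` ~` B : set (borel X * borel X)).
  by apply: measurableX => //; exact: measurableC.
apply: (@le_trans _ _ (r%:E * rho (A `*` ~` B))%E); last first.
  by apply: markov_nonmeasurable => // -[x y] [/= Ax By]; exact: dr.
rewrite EFinM lee_wpmul2l ?lee_fin //.
rewrite -[A `*` ~` B]setCK probability_setC; last exact: measurableC.
(* The complement is covered by two cylinders, whose masses are given by the marginals: 0 and at
   most [1 - t]. *)
have sub : ~` (A `*` ~` B) `<=` (~` A `*` setT) `|` (setT `*` B).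
  move=> [x y] /= nAB; have [Ax|nAx] := pselect (A x); last by left.
  by right; split=> //; apply: contrapT => nBy; apply: nAB.
have mAT : measurable (~` A `*` setT : set (borel X * borel X)).
  by apply: measurableX => //; exact: measurableC.
have mTB : measurable (setT `*` B : set (borel X * borel X)).
  exact: measurableX.
have le_nu : (rho (~` (A `*` ~` B)) <= (1 - t)%:E)%E.
  apply: le_trans (le_measure _ _ _ sub) _; rewrite ?inE //.
  - exact: measurableC.
  - exact: measurableU.
  apply: le_trans (measureU2 _ _ _) _ => //.
  rewrite -[leRHS]add0e; apply: leeD.
    by rewrite -muA -(rhoE _ (measurableC mA)).1.
  by apply: le_trans nuB; rewrite -(rhoE _ mB).2.
apply: (@le_trans _ _ (1 - (1 - t)%:E)%E); last exact: leeB.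
by rewrite -EFinB opprB addrC subrK.
Qed.

End WassersteinLowerBound.

(** * Choice of the radius and of the constant *)

Theorem mainTheorem2 (R : realType) (n : nat) (n_gt0 : (0 < n)%N)
    (X : ptopologicalType) (X_hausdorff : hausdorff_space X)
    (X_compact : compact [set: X]) (X_connected : connected [set: X])
    (M : complexManifold R n X) (h : hermitianMetric M)
    (sigma : probability (borel X) R)
    (sigma_smooth : nowhere_vanishing_smooth h sigma)
    (E : nat -> {fset X})
    (A : R) (A_ge1 : 1 <= A)
    (card_E : forall k, (0 < k)%N ->
      A^-1 * k%:R ^+ n <= #|` E k|%:R <= A * k%:R ^+ n)
    (mu : nat -> probability (borel X) R)
    (mu_E : forall k, (0 < k)%N -> empirical_measure (E k) (mu k)) :
  exists2 c : R, 0 < c & forall k, (0 < k)%N ->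
    ((c / Num.sqrt k%:R)%:E <= wasserstein (hdist h) (mu k) sigma)%E.
Proof.
have [e /andP[e0 e1] good] :=
  uniform_ball_estimate X_hausdorff X_compact sigma_smooth.
have A0 : 0 < A by exact: lt_le_trans A_ge1.
(* Chosen so that the final mass bound [A * e^-1 * (e * delta)] equals 1/2. *)
pose delta : R := (2 * A)^-1.
have d0 : 0 < delta by rewrite invr_gt0 mulr_gt0.
have d1 : delta <= 1 by rewrite invf_le1 ?mulr_gt0 //; lra.
(* The distance [e * r] times the moved mass 1/2, with the factor [1 / sqrt k] of [r] removed. *)
exists (e * (e * delta) / 2); first by rewrite !mulr_gt0.
move=> k k0; set s := Num.sqrt k%:R.
have kR0 : 0 < k%:R :> R by rewrite ltr0n.
have s0 : 0 < s by rewrite sqrtr_gt0.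
have s1 : 1 <= s by rewrite -sqrtr1 ler_wsqrtr // ler1n.
(* Since [s ^ (2n) = k ^ n], the factor [r ^ (2n)] cancels the growth of the cardinality of
   [E k]. *)
pose r := e * delta / s.
have re : 0 < r <= e.
  apply/andP; split; first by rewrite /r divr_gt0 ?mulr_gt0.
  rewrite /r -mulrA ger_pMr // ler_pdivrMr // mul1r.
  exact: le_trans d1 s1.
have [U UE] := choice (fun x => good x r re).
have [mB muB] := @measure_bigsetU_le _ _ _ sigma _ (enum_fset (E k)) U _
  (fun x => let: And3 mU _ _ := UE x in mU) (fun x => let: And3 _ sU _ := UE x in sU).
set B := \big[_/_]_(_ <- _) _ in mB muB.
have -> : e * (e * delta) / 2 / s = (e * r) * 2^-1.
  by rewrite /r; field; rewrite gt_eqF.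
apply: (@wasserstein_ge _ _ _ _ _ [set` E k] B) => //.
- exact: hdist_ge0.
- by have /andP[/ltW r0 _] := re; rewrite mulr_ge0 // ltW.
- exact: fset_borel.
- by apply: empirical_measure_setC => //; exact: mu_E.
- apply: le_trans muB _; rewrite lee_fin.
  have /andP[_ cardA] := card_E k k0.
  have q0 : 0 < e^-1 * r ^+ (n + n).
    by rewrite mulr_gt0 ?invr_gt0 // exprn_gt0 //; have /andP[] := re.
  apply: (@le_trans _ _ (A * k%:R ^+ n * (e^-1 * r ^+ (n + n)))).
    by rewrite ler_pM2r.
  have -> : A * k%:R ^+ n * (e^-1 * r ^+ (n + n)) = A * e^-1 * (e * delta) ^+ (n + n).
    rewrite /r expr_div_n.
    have -> : s ^+ (n + n) = k%:R ^+ n.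
      by rewrite addnn -mul2n exprM sqr_sqrtr // ltW.
    by field; rewrite gt_eqF //= expf_neq0 // gt_eqF.
  have ed0 : 0 <= e * delta by rewrite mulr_ge0 // ltW.
  (* As [e * delta <= 1] and [n] is positive, the power [n + n] is at most the first power. *)
  apply: (@le_trans _ _ (A * e^-1 * (e * delta))).
    rewrite ler_pM2l ?mulr_gt0 ?invr_gt0 //.
    have n2 : (0 < n + n)%N by rewrite addn_gt0 n_gt0.
    rewrite -(prednK n2) exprS ger_pMr ?mulr_gt0 // exprn_ile1 //.
    by rewrite mulr_ile1 // ltW.
  by rewrite le_eqVlt; apply/orP; left; apply/eqP; rewrite /delta; field; rewrite !gt_eqF.
(* A point outside [B] lies outside the set [U x] attached to each [x] in [E k], so it is far from
   all of them. *)
- move=> x y /= xE By; have [_ _ far] := UE x; apply: far => Uy; apply: By.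
  by rewrite /B -bigcup_seq; exists x.
Qed.
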